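(* Let $q$ be a power of $2$ such that $q-1$ is squarefree, and let $m \ge 2$. Suppose that for every partition $\lambda$ of $m$, every element of $\mathbb{F}_q^\times$ is the discriminant of the same number of polynomials in $S_{\lambda,\mathbb{F}_q}$. Then $\gcd(q-1, m(m-1)) = 1$.
   Context: For a partition $\lambda = (\lambda_1,\dots,\lambda_k)$ of $m$, a monic $f \in \mathbb{F}_q[x]$ of degree $m$ has factorization type $\lambda$ if $f = \pi_1\cdots\pi_k$ with the $\pi_i$ distinct monic irreducible polynomials and $\deg \pi_i = \lambda_i$. $S_{\lambda,\mathbb{F}_q}$ is the set of monic squarefree polynomials in $\mathbb{F}_q[x]$ of factorization type $\lambda$. For $f$ of degree $m\ge 2$ with leading coefficient $a_m$ and roots $\alpha_i$ in a splitting field, $\operatorname{disc}(f) = a_m^{2m-2}\prod_{i<j}(\alpha_i-\alpha_j)^2$. *)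

(* Defs.v *)
From HB Require Import structures.
From mathcomp Require Import all_boot all_order all_algebra all_field.
From mathcomp Require Import boolp.
Set Implicit Arguments.
Unset Strict Implicit.
Unset Printing Implicit Defensive.
Import GRing.Theory.
Local Open Scope ring_scope.

Definition is_partition (m : nat) (l : seq nat) : bool :=
  [&& sorted geq l, all (fun x => 0 < x)%N l & sumn l == m].

Definition squarefree_nat (n : nat) : Prop :=
  forall d : nat, (1 < d)%N -> ~~ (d * d %| n)%N.

Definition has_fact_type (F : fieldType) (lam : seq nat) (f : {poly F}) : Prop :=
  exists s : seq {poly F},
    [/\ uniq s,
        all (fun p : {poly F} => p \is monic) s,
        (forall p, p \in s -> irreducible_poly p),
        f = \prod_(p <- s) p
      & map (fun p : {poly F} => (size p).-1) s = lam].

Definition is_disc (F : fieldType) (f : {poly F}) (d : F) : Prop :=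
  exists (L : fieldExtType F) (rs : seq L),
    let m := size rs in
    [/\ (size f).-1 = m,
        map_poly (in_alg L) f = (lead_coef f)%:A%:P * \prod_(r <- rs) ('X - r%:P)
      & d%:A = (lead_coef f)%:A ^+ (2 * m - 2) *
               \prod_(i < m) \prod_(j < m | (i < j)%N) (rs`_i - rs`_j) ^+ 2].

Definition monic_of (F : fieldType) (m : nat) (t : m.-tuple F) : {poly F} :=
  'X^m + \poly_(i < m) t`_i.

Definition count_disc (F : finFieldType) (m : nat) (lam : seq nat) (a : F) : nat :=
  #|[set t : m.-tuple F | `[< has_fact_type lam (monic_of t) /\ is_disc (monic_of t) a >]]|.

(* Main.v *)
(* Every polynomial of factorization type lam is separable, so equidistribution
   of the discriminants forces q - 1 to divide the cardinal of S_lam, for every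
   partition lam of m. Suppose a prime p divides both q - 1 and m(m - 1). Then
   m = p M + r with r <= 1; take for lam the parts p 2^b, for b running over the
   binary digits of M, together with r parts equal to 1. These parts are
   pairwise distinct, so |S_lam| is the product of the N_d over the parts d,
   where N_d is the number of monic irreducible polynomials of degree d. From
   sum_(d | n) d N_d = q^n and the fact that p^2 does not divide q - 1, p does
   not divide N_(p 2^b); nor does it divide N_1 = q. Hence p does not divide
   |S_lam|, a contradiction. *)
Require Import Defs.
From HB Require Import structures.
From mathcomp Require Import all_boot all_order all_algebra all_field.
From mathcomp Require Import fingroup cyclic.
From mathcomp Require Import boolp ring zify.
Set Implicit Arguments.
Unset Strict Implicit.
Unset Printing Implicit Defensive.
Import GRing.Theory.
Local Open Scope ring_scope.

(** * The discriminant as a Hankel determinant *)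

Section Discriminant.

Variable F : fieldType.
Implicit Types (f : {poly F}) (L : fieldExtType F).

(* If [f] is monic with roots [r_i], this is [\sum_i r_i ^+ k] (see
   [power_sumE]), but it is computed inside [F]: the discriminant thus depends
   neither on the splitting field nor on the order of the roots. *)
Definition power_sum f k : F := ((f^`() * 'X^k) %% f)`_(size f).-2.

(** For monic [f] that splits, this matrix is [V *m V^T] with [V] the Vandermonde matrix of the
    roots, so its determinant is the discriminant. *)
Definition hankel_disc f : F :=
  \det (\matrix_(i < (size f).-1, j < (size f).-1) power_sum f (i + j)).

(* Differentiating the factor ['X - r] of [f] contributes
   [f / ('X - r) * 'X^k = r ^+ k *: (f / ('X - r))] modulo [f]. *)
Lemma deriv_prod_XsubC_modp (R : fieldType) (rs : seq R) k
    (f := \prod_(r <- rs) ('X - r%:P)) (g := (f^`() * 'X^k) %% f) :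
  (g * 'X)`_(size rs) = \sum_(r <- rs) r ^+ k.
Proof.
(* Multiplying by ['X] shifts the index: the coefficient of degree [size rs - 1] is read, and 0 when
   [rs] is empty. *)
suff [h [g0 [dE szg cg]]] : exists h g0, [/\ f^`() * 'X^k = h * f + g0,
    (size g0 <= size rs)%N & (g0 * 'X)`_(size rs) = \sum_(r <- rs) r ^+ k].
  rewrite /g dE modpD modp_mull add0r modp_small //.
  by rewrite size_prod_XsubC ltnS.
rewrite /f {f g}; elim: rs => [|r rs [h [g0 [dE szg cg]]]].
  exists 0, 0; rewrite !big_nil derivC !mul0r addr0 size_poly0 coef0.
  by split.
rewrite !big_cons; set f0 := \prod_(_ <- rs) _ in dE *.
have szf0 : size f0 = (size rs).+1 by rewrite size_prod_XsubC.
have /factor_theorem[c cE] : root ('X^k - (r ^+ k)%:P) r.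
  by rewrite rootE !hornerE subrr.
(* [c] is the quotient of ['X^k - r ^+ k] by ['X - r]: replacing [f0 * 'X^k] by [r ^+ k *: f0] costs
   the multiple [c * ('X - r) * f0] of the new product. *)
exists (h + c), (r ^+ k *: f0 + ('X - r%:P) * g0); split.
- rewrite derivM derivXsubC mul1r mulrDl -mulrA dE.
  rewrite -[X in f0 * X](subrK (r ^+ k)%:P) cE -mul_polyC.
  ring.
- apply: leq_trans (size_polyD _ _) _; rewrite geq_max.
  rewrite (leq_trans (size_scale_leq _ _)) ?szf0 //=.
  apply: leq_trans (size_polyMleq _ _) _.
  by rewrite size_XsubC.
rewrite /= coefMX /= coefD coefZ mulrBl coefB coefXM coefCM.
have -> : f0`_(size rs) = 1.
  by rewrite -[size rs]/(size rs).+1.-1 -szf0 -lead_coefE lead_coef_prod_XsubC.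
rewrite mulr1 [g0`_(size rs)]nth_default // mulr0 subr0; congr (_ + _).
by rewrite -cg coefMX.
Qed.

Lemma power_sumE f L (rs : seq L) k :
  map_poly (in_alg L) f = \prod_(r <- rs) ('X - r%:P) ->
  (power_sum f k)%:A = \sum_(r <- rs) r ^+ k.
Proof.
move=> fE.
have szf : size f = (size rs).+1 by rewrite -(size_map_poly (in_alg L)) fE size_prod_XsubC.
rewrite /power_sum -in_algE -coef_map map_modp rmorphM /= -deriv_map map_polyXn fE.
(* For [rs] empty, [f] is 1 and both the remainder and the sum vanish. *)
rewrite -deriv_prod_XsubC_modp coefMX szf /=; case: rs fE szf => //= _.
by rewrite big_nil modp1 coef0.
Qed.

Lemma hankel_discE f L (rs : seq L) :
  map_poly (in_alg L) f = \prod_(r <- rs) ('X - r%:P) ->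
  (hankel_disc f)%:A
    = \prod_(i < size rs) \prod_(j < size rs | (i < j)%N) (rs`_i - rs`_j) ^+ 2.
Proof.
move=> fE.
have szf : size f = (size rs).+1 by rewrite -(size_map_poly (in_alg L)) fE size_prod_XsubC.
rewrite /hankel_disc szf -in_algE -det_map_mx /=.
pose V := Vandermonde (size rs) (\row_(j < size rs) rs`_j).
transitivity (\det (V *m V^T)); last first.
  rewrite det_mulmx det_tr det_Vandermonde -big_split /=; apply: eq_bigr => i _.
  rewrite -big_split /=; apply: eq_bigr => j _.
  by rewrite !mxE -expr2 -sqrrN opprB.
congr (\det _); apply/matrixP => i j; rewrite !mxE.
rewrite [LHS](power_sumE _ fE) (big_nth 0) big_mkord; apply: eq_bigr => l _.
by rewrite !mxE exprD.
Qed.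

(** Whatever extension witnesses [is_disc], [hankel_discE] evaluates its product to the image of one
    and the same element of [F], and [F] embeds injectively. *)
Lemma is_discE f d (L : fieldExtType F) (rs : seq L) : f \is monic ->
  map_poly (in_alg L) f = \prod_(r <- rs) ('X - r%:P) ->
  is_disc f d <-> d = hankel_disc f.
Proof.
move=> mf fE; split.
  case=> L' [rs'] /= [_ fE' dE].
  move: fE' dE; rewrite (monicP mf) scale1r mul1r expr1n mul1r => /hankel_discE <-.
  exact: (fmorph_inj (in_alg L')).
move=> ->; exists L, rs; rewrite /= (monicP mf) scale1r mul1r expr1n mul1r.
split=> //; last exact: hankel_discE.
by rewrite -(size_map_poly (in_alg L)) fE size_prod_XsubC.
Qed.

Lemma hankel_disc_neq0 f (L : fieldExtType F) (rs : seq L) :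
  map_poly (in_alg L) f = \prod_(r <- rs) ('X - r%:P) ->
  separable_poly f -> hankel_disc f != 0.
Proof.
move=> fE sf.
rewrite -(fmorph_eq0 (in_alg L)) /= (hankel_discE fE).
have urs : uniq rs by rewrite -separable_prod_XsubC -fE separable_map.
rewrite prodf_seq_neq0; apply/allP => i _ /=.
rewrite prodf_seq_neq0; apply/allP => j _ /=; apply/implyP => lt_ij.
rewrite expf_neq0 // subr_eq0 nth_uniq // neq_ltn lt_ij //.
Qed.

End Discriminant.

(** * Divisibility of necklace numbers *)

Section Arithmetic.

Local Open Scope nat_scope.

Variables (p q : nat).
Hypotheses (p_pr : prime p) (p_odd : odd p) (q_gt0 : (0 < q)) (p_q1 : (p %| q.-1)).

Lemma sum_exp_mod n : \sum_(i < n) q ^ i = n %[mod p].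
Proof.
have q1 : q = 1 %[mod p] by apply/eqP; rewrite eqn_mod_dvd // subn1.
elim: n => [|n IHn]; first by rewrite big_ord0.
by rewrite big_ord_recr /= -modnDm IHn -modnXm q1 modnXm exp1n modnDm addn1.
Qed.

(** One [p] comes from the factor [q - 1], the other from the cofactor, a sum of [m] terms congruent
    to 1. *)
Lemma sqr_dvdn_exp_pred m : (p %| m) -> (p * p %| (q ^ m).-1).
Proof.
move=> pm; rewrite predn_exp dvdn_mul //.
by rewrite /dvdn sum_exp_mod; exact: pm.
Qed.

Lemma coprime_sum_exp b : coprime p (\sum_(i < 2 ^ b) q ^ i).
Proof.
rewrite prime_coprime // /dvdn sum_exp_mod -/(dvdn p _).
by rewrite -prime_coprime // coprimeXr // coprimen2.
Qed.

Lemma dvdn_exp2_succ e b : e %| 2 ^ b.+1 -> (e %| 2 ^ b) || (e == 2 ^ b.+1).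
Proof.
case/(dvdn_pfactor _ _ (isT : prime 2)) => j; rewrite leq_eqVlt.
by case/orP=> [/eqP-> -> | lt_jb ->]; rewrite ?eqxx ?orbT // dvdn_exp2l.
Qed.

Lemma dvdn_prime_mul_exp2 d b : (d %| p * 2 ^ b.+1) ->
  [|| (d %| p * 2 ^ b), d == 2 ^ b.+1 | d == p * 2 ^ b.+1]%N.
Proof.
have [/dvdnP[e ->] | pNd] := boolP (p %| d).
  rewrite mulnC dvdn_pmul2l ?prime_gt0 // => /dvdn_exp2_succ/orP[e2|/eqP->].
    by rewrite dvdn_mul.
  by rewrite eqxx !orbT.
rewrite Gauss_dvdr; last by rewrite coprime_sym prime_coprime.
by case/dvdn_exp2_succ/orP=> [e2 | ->]; rewrite ?orbT // dvdn_mull.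
Qed.

(* [N d] stands for the number of monic irreducible polynomials of degree [d]. *)
Variable N : nat -> nat.
Hypothesis sum_N : forall n, (0 < n) -> (\sum_(d <- divisors n) d * N d = q ^ n).

(** Subtract [sum_N] at [n] from [sum_N] at [n']: only the divisors listed in [l] survive. *)
Lemma exp_new_divisors n n' l : 0 < n' -> n %| n' -> uniq l ->
  (forall d, (d \in l) = (d %| n') && ~~ (d %| n)) ->
  q ^ n' = q ^ n + \sum_(d <- l) d * N d.
Proof.
move=> n'0 n_n' ul lE; have n0 := dvdn_gt0 n'0 n_n'.
rewrite -!sum_N // -big_cat; apply: perm_big; apply: uniq_perm.
- exact: divisors_uniq.
- rewrite cat_uniq divisors_uniq ul andbT /=.
  by apply/hasPn => d; rewrite lE -dvdn_divisors // => /andP[].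
move=> d; rewrite mem_cat -!dvdn_divisors // lE.
by have [d_n | _] := boolP (d %| n); rewrite ?andbT // (dvdn_trans d_n).
Qed.

Lemma exp_prime_irr : q ^ p = q + p * N p.
Proof.
rewrite -[q in RHS]expn1 (@exp_new_divisors 1 p [:: p]) ?big_seq1 ?prime_gt0 //.
move=> d; rewrite inE dvdn1; apply/eqP/andP => [->|[d_p d1]].
  by rewrite dvdnn neq_ltn prime_gt1 ?orbT.
by apply/eqP; rewrite -dvdn_prime2 // (prime_nt_dvdP _ _ d_p).
Qed.

Lemma exp_exp2_irr b : q ^ 2 ^ b.+1 = q ^ 2 ^ b + 2 ^ b.+1 * N (2 ^ b.+1).
Proof.
rewrite (@exp_new_divisors (2 ^ b) _ [:: 2 ^ b.+1]) ?big_seq1 ?expn_gt0 ?dvdn_exp2l //.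
move=> d; rewrite inE; apply/eqP/andP => [-> | [/dvdn_exp2_succ/orP[-> //|/eqP //]]].
by rewrite dvdnn dvdn_Pexp2l // ltnn.
Qed.

Lemma exp_prime_exp2_irr b : q ^ (p * 2 ^ b.+1) = q ^ (p * 2 ^ b)
  + (2 ^ b.+1 * N (2 ^ b.+1) + p * 2 ^ b.+1 * N (p * 2 ^ b.+1)).
Proof.
have p0 := prime_gt0 p_pr; have p1 := prime_gt1 p_pr.
rewrite (@exp_new_divisors (p * 2 ^ b) _ [:: 2 ^ b.+1; p * 2 ^ b.+1]).
- by rewrite big_cons big_seq1.
- by rewrite muln_gt0 p0 expn_gt0.
- by rewrite dvdn_pmul2l // dvdn_exp2l.
- by rewrite /= inE -[X in X == _]mul1n eqn_pmul2r ?expn_gt0 // ltn_eqF.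
move=> d; rewrite !inE; apply/orP/andP => [[]/eqP-> | [/dvdn_prime_mul_exp2]].
- rewrite dvdn_mull // Gauss_dvdr ?dvdn_Pexp2l ?ltnn //.
  by rewrite coprimeXl // coprime2n.
- by rewrite dvdnn dvdn_pmul2l // dvdn_Pexp2l // ltnn.
by case/or3P=> [-> //| ->|->]; [left|right].
Qed.

Hypothesis p2Nq1 : ~~ (p * p %| q.-1).

Lemma prime_dvdn_N b : ~~ (p %| N (p * 2 ^ b)).
Proof.
have p0 := prime_gt0 p_pr.
apply: contra p2Nq1; case: b => [|b] pN.
  rewrite muln1 in pN.
  (* Here [q ^ p - 1 = (q - 1) + p * N p], and [p * p] divides both the left side and the last
     term. *)
  have := sqr_dvdn_exp_pred (dvdnn p); rewrite exp_prime_irr -!subn1 addnC -addnBA //.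
  by rewrite dvdn_addr // dvdn_pmul2l.
(* Modulo [p * p], both powers of [q] in [exp_prime_exp2_irr] are 1 and the term in
   [N (p * 2 ^ b.+1)] vanishes. *)
have : (p * p %| 2 ^ b.+1 * N (2 ^ b.+1)).
  have := sqr_dvdn_exp_pred (dvdn_mulr (2 ^ b.+1) (dvdnn p)).
  have := sqr_dvdn_exp_pred (dvdn_mulr (2 ^ b) (dvdnn p)).
  rewrite exp_prime_exp2_irr -!subn1 => d1; rewrite addnC -addnBA ?expn_gt0 ?q_gt0 //.
  rewrite dvdn_addl // dvdn_addl //.
  by rewrite -mulnA dvdn_pmul2l // dvdn_mull.
(* This number is [q ^ 2 ^ b * (q ^ 2 ^ b - 1)]. Since [q] and the geometric sum
   [(q ^ 2 ^ b - 1) / (q - 1)] are prime to [p], the square [p * p] divides [q - 1]. *)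
rewrite -(addKn (q ^ 2 ^ b) (2 ^ b.+1 * _)) -exp_exp2_irr expnS mul2n -addnn expnD.
rewrite -[X in (_ - X)]muln1 -mulnBr subn1 Gauss_dvdr; last first.
  rewrite coprimeXr // coprimeMl andbb prime_coprime // /dvdn.
  have /eqP-> : q == 1 %[mod p] by rewrite eqn_mod_dvd // subn1.
  by rewrite modn_small ?prime_gt1.
by rewrite predn_exp Gauss_dvdl // coprimeMl coprime_sum_exp.
Qed.

End Arithmetic.

(** * Irreducible polynomials over a finite field *)

Section FiniteField.

Variable F : finFieldType.
Local Notation q := #|F|.
Implicit Types (p f : {poly F}).

Lemma natr_card : q%:R = 0 :> F.
Proof.
have := @expg_cardG F [group of [set: F]] 1%R (in_setT _).
by rewrite FinRing.zmodXgE cardsT => ->.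
Qed.

(** The derivative is the constant -1, because [q] is 0 in [F]. *)
Lemma separable_XqnX n : (0 < n)%N -> separable_poly ('X^(q ^ n) - 'X : {poly F}).
Proof.
move=> n0; rewrite unlock derivB derivXn derivX -[_ *+ _]mulr_natr.
rewrite natrX -polyC_natr natr_card -polyC_exp expr0n eqn0Ngt n0 mulr0 sub0r.
by apply/Bezout_eq1_coprimepP; exists (0, -1); rewrite /= mul0r add0r mulrNN mulr1.
Qed.

Lemma map_XqnX (L : fieldExtType F) n :
  map_poly (in_alg L) ('X^n - 'X) = 'X^n - 'X.
Proof. by rewrite rmorphB /= map_polyXn map_polyX. Qed.

Lemma irredp_dvdp_root (L : fieldExtType F) p f (x : L) : irreducible_poly p ->
  root (map_poly (in_alg L) p) x -> root (map_poly (in_alg L) f) x -> p %| f.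
Proof.
move=> irr px fx; apply: contraT; rewrite -irreducible_poly_coprime //.
rewrite -(coprimep_map (in_alg L)) => /coprimep_root/(_ px).
by move/rootP: fx => ->; rewrite eqxx.
Qed.

Lemma root_XqnX (L : fieldExtType F) (K : {subfield L}) x n : x \in K ->
  (\dim K %| n)%N -> x ^+ (q ^ n) = x.
Proof.
rewrite Fermat's_little_theorem => /eqP xK /dvdnP[k ->].
elim: k => [|k IHk]; first by rewrite expn0 expr1.
by rewrite mulSn expnD exprM xK.
Qed.

Lemma irredp_dvdp_XqnX p n : irreducible_poly p ->
  ((size p).-1 %| n)%N -> p %| 'X^(q ^ n) - 'X.
Proof.
move=> irr dvd_n; have [L dimL [z pz _]] := irredp_FAdjoin irr.
apply: (irredp_dvdp_root irr pz).
rewrite map_XqnX rootE !hornerE (@root_XqnX _ {:L}%AS) ?subrr ?memvf //=.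
by rewrite dimL.
Qed.

Lemma prod_irredp_dvdp (s : seq {poly F}) f : uniq s ->
  (forall p, p \in s -> [/\ p \is monic, irreducible_poly p & p %| f]) ->
  \prod_(p <- s) p %| f.
Proof.
elim: s => [|p s IHs] /=; first by rewrite big_nil dvd1p.
case/andP=> pNs us hs; rewrite big_cons.
have [mp irr pf] := hs p (mem_head _ _).
rewrite Gauss_dvdp ?pf ?IHs //=.
  by move=> r rs; apply: hs; rewrite inE rs orbT.
rewrite big_seq; apply: (big_rec (fun r => coprimep p r)) => [|r t rs cpt].
  exact: coprimep1.
have [mr irr_r _] : [/\ r \is monic, irreducible_poly r & r %| f].
  by apply: hs; rewrite inE rs orbT.
rewrite coprimepMr cpt andbT irreducible_poly_coprime //.
apply: contra pNs => p_r.
have := apply_irredp irr_r _ p_r; rewrite eqp_monic // => /(_ _)/eqP-> //.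
by rewrite neq_ltn [X in _ || X]irr orbT.
Qed.

(** Distinct monic irreducibles are pairwise coprime, so their product divides the separable
    ['X^(q ^ n) - 'X] once [n] is a common multiple of their degrees. *)
Lemma fact_type_separable lam f : has_fact_type lam f -> separable_poly f.
Proof.
case=> s [us ms irr_s -> _].
have pos p : p \in s -> (0 < (size p).-1)%N.
  by move/irr_s=> [sz _]; rewrite -subn1 subn_gt0.
pose n := (\prod_(p <- s) (size p).-1)%N.
apply: (@dvdp_separable _ ('X^(q ^ n) - 'X)); last first.
  apply: separable_XqnX; rewrite /n big_seq.
  by apply: (big_ind (fun n => 0 < n)%N) => // a b; rewrite muln_gt0 => -> ->.
apply: prod_irredp_dvdp => // p ps; split; first exact: (allP ms).
  exact: irr_s.
apply: irredp_dvdp_XqnX; first exact: irr_s.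
by rewrite /n (big_rem p) //= dvdn_mulr.
Qed.

(** * Discriminants over a finite field *)

Lemma poly_splits f : f \is monic ->
  exists (L : fieldExtType F) (rs : seq L),
    map_poly (in_alg L) f = \prod_(r <- rs) ('X - r%:P).
Proof.
move=> mf; have [L [rs fE _]] := FinSplittingFieldFor (monic_neq0 mf).
exists L, rs; apply/eqP.
by rewrite -eqp_monic // ?monic_prod_XsubC // map_monic.
Qed.

Lemma is_disc_hankel f d : f \is monic -> is_disc f d <-> d = hankel_disc f.
Proof. by move=> mf; have [L [rs fE]] := poly_splits mf; apply: is_discE fE. Qed.

Lemma hankel_disc_fact_type lam f : f \is monic -> has_fact_type lam f ->
  hankel_disc f != 0.
Proof.
move=> mf hf; have [L [rs fE]] := poly_splits mf.
exact: (hankel_disc_neq0 fE) (fact_type_separable hf).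
Qed.

(** * Extensions of every degree *)

Lemma card_exp_gt1 n : (0 < n)%N -> (1 < q ^ n)%N.
Proof. by move=> n0; rewrite (ltn_exp2l 0) ?finNzRing_gt1. Qed.

Lemma size_XqnX n : (0 < n)%N -> size ('X^(q ^ n) - 'X : {poly F}) = (q ^ n).+1.
Proof.
move=> n0; rewrite size_polyDl ?size_polyXn // size_polyN size_polyX ltnS.
exact: card_exp_gt1.
Qed.

Lemma monic_XqnX n : (0 < n)%N -> 'X^(q ^ n) - 'X \is @monic F.
Proof.
move=> n0; rewrite monicE lead_coefDl ?lead_coefXn //.
rewrite size_polyXn size_polyN size_polyX ltnS.
exact: card_exp_gt1.
Qed.

(** In a splitting field of ['X^(q ^ n) - 'X], the fixed field of the [n]-th power of Frobenius
    consists of the [q ^ n] roots, hence has dimension [n]. *)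
Lemma exists_ext n : (0 < n)%N -> exists L : fieldExtType F, \dim {:L} = n.
Proof.
move=> n0; have [L [rs fE _]] := FinSplittingFieldFor (monic_neq0 (monic_XqnX n0)).
move: fE => /=; rewrite map_XqnX => fE.
have {}fE : 'X^(q ^ n) - 'X = \prod_(r <- rs) ('X - r%:P).
  by apply/eqP; rewrite -eqp_monic ?monic_prod_XsubC // -map_XqnX map_monic monic_XqnX.
have urs : uniq rs.
  by rewrite -separable_prod_XsubC -fE -map_XqnX separable_map separable_XqnX.
have szrs : size rs = (q ^ n)%N.
  by apply: succn_inj; rewrite -(size_prod_XsubC rs id) -fE -map_XqnX size_map_poly size_XqnX.
have [a _ aE] := finField_galois_generator (sub1v {:L}%AS).
have anE k x : (a ^+ k)%g x = x ^+ (q ^ k).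
  elim: k => [|k IHk]; first by rewrite gal_id expr1.
  by rewrite expgSr galM ?memvf // IHk aE ?memvf // dimv1 expn1 expnSr exprM.
pose K := fixedField [set (a ^+ n)%g].
have KE x : (x \in K) = (x \in rs).
  rewrite -root_prod_XsubC -fE rootE !hornerE subr_eq0.
  apply/fixedFieldP/eqP => [|/(_ _ (set11 _))|xn _ /set1P->]; rewrite ?memvf //.
    by rewrite anE.
  by rewrite anE.
exists (subvs_of K); rewrite dimvf /= /dim /=.
have := @card_vspace F (finvect_type L) _ K.
rewrite (eq_card (B := mem (rs : seq (finvect_type L)))); last exact: KE.
have /card_uniqP -> : uniq (rs : seq (finvect_type L)) by [].
by rewrite szrs => /eqP; rewrite eqn_exp2l ?finNzRing_gt1 // => /eqP.
Qed.

(** * Coefficient tuples and the count of irreducibles by degree *)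

Definition coef_tuple m f : m.-tuple F := [tuple f`_i | i < m].

Lemma size_monic_of m (t : m.-tuple F) : size (monic_of t) = m.+1.
Proof. by rewrite size_polyDl size_polyXn // ltnS size_poly. Qed.

Lemma monic_of_monic m (t : m.-tuple F) : monic_of t \is monic.
Proof. by rewrite monicE lead_coefDl ?lead_coefXn // size_polyXn ltnS size_poly. Qed.

Lemma monic_ofK m : cancel (@monic_of F m) (coef_tuple m).
Proof.
move=> t; apply: eq_from_tnth => i; rewrite tnth_mktuple coefD coefXn coef_poly.
by rewrite ltn_ord (ltn_eqF (ltn_ord i)) add0r (tnth_nth 0).
Qed.

Lemma coef_tupleK m f : f \is monic -> size f = m.+1 ->
  monic_of (coef_tuple m f) = f.
Proof.
move=> mf szf; apply/polyP => i; rewrite coefD coefXn coef_poly.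
case: ltngtP => [lt_im|lt_mi|->]; last first.
- by move/monicP: mf; rewrite lead_coefE szf addr0.
- by rewrite add0r nth_default // szf.
by rewrite add0r (nth_map (Ordinal lt_im)) ?size_enum_ord // nth_enum_ord.
Qed.

Definition irr_tuples d := [set t : d.-tuple F | irreducibleb (monic_of t)].

(** [minPoly 1 x] has its coefficients in the copy of [F] inside [L], so it descends to [F]. *)
Lemma min_poly_over (L : fieldExtType F) (x : L) : exists p : {poly F},
  [/\ map_poly (in_alg L) p = minPoly 1 x, p \is monic, irreducible_poly p
    & size p = (\dim <<1; x>>).+1].
Proof.
have /polyOver1P[p pE] := minPolyOver 1 x.
have szp : size p = (\dim <<1; x>>).+1.
  by rewrite -(size_map_poly (in_alg L)) -pE size_minPoly dim_Fadjoin dimv1 muln1.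
exists p; split=> //; first by rewrite -(map_monic (in_alg L)) -pE monic_minPoly.
split=> [|f szf f_p]; first by rewrite szp ltnS adim_gt0.
have := @minPoly_irr _ _ 1%AS x _ (alg_polyOver _ f).
rewrite pE dvdp_map eqp_map f_p -size_poly_eq1 size_map_poly (negPf szf) orbF.
exact.
Qed.

Lemma irredp_dim (L : fieldExtType F) p (x : L) : irreducible_poly p ->
  root (map_poly (in_alg L) p) x -> \dim <<1; x>> = (size p).-1.
Proof.
move=> irr px; have [r [rE mr irr_r szr]] := min_poly_over x.
have : r %| p by apply: (irredp_dvdp_root irr_r) px; rewrite rE root_minPoly.
have szr1 : size r != 1%N by rewrite szr eqSS -lt0n adim_gt0.
by move/(apply_irredp irr szr1)/eqp_size <-; rewrite szr.
Qed.

Lemma card_finvect (L : fieldExtType F) : #|finvect_type L| = (q ^ \dim {:L})%N.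
Proof.
have <- := @card_vspace F (finvect_type L) _ {:L}%VS.
by apply: eq_card => x; rewrite (@memvf _ L).
Qed.

(** [p] divides the product of ['X - x] over all [x] in [L], so it splits there into distinct linear
    factors. *)
Lemma card_roots_irredp (L : fieldExtType F) p : irreducible_poly p ->
  ((size p).-1 %| \dim {:L})%N ->
  #|[set x : finvect_type L | root (map_poly (in_alg L) p) x]| = (size p).-1.
Proof.
move=> irr dvd_p.
have := irredp_dvdp_XqnX irr dvd_p.
rewrite -(dvdp_map (in_alg L)) map_XqnX.
rewrite -card_finvect (finField_genPoly (finvect_type L)) -big_enum /=.
case/dvdp_prod_XsubC => m; set s := mask _ _ => pE.
have us : uniq s by rewrite mask_uniq ?enum_uniq.
rewrite -(size_map_poly (in_alg L)) (eqp_size pE) size_prod_XsubC /= -(card_uniqP us).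
apply: eq_card => x; rewrite inE.
by rewrite (eqp_root pE) root_prod_XsubC.
Qed.

(** The elements of an extension of degree [n] are sorted by their degree [d], then by minimal
    polynomial; each irreducible of degree [d] collects exactly its [d] roots. *)
Lemma sum_irr_tuples n : (0 < n)%N ->
  (\sum_(d < n.+1 | d %| n) d * #|irr_tuples d| = q ^ n)%N.
Proof.
move=> n0; have [L dimL] := exists_ext n0.
have dvd_dim (x : L) : (\dim <<1; x>> %| n)%N.
  by rewrite -dimL field_dimS ?subvf.
pose deg (x : finvect_type L) : 'I_n.+1 := inord (\dim (<<1; x>>%VS : {vspace L})).
have degE x : deg x = \dim (<<1; x>>%VS : {vspace L}) :> nat.
  by rewrite inordK // ltnS dvdn_leq.
rewrite -[X in (q ^ X)%N]dimL -card_finvect -sum1_card (partition_big deg (fun d => d %| n)%N) /=; last first.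
  by move=> x _; rewrite degE.
apply: eq_bigr => d dvd_d.
have /choice[mp mpP] := @min_poly_over L.
have mem_irr (x : finvect_type L) : deg x = d -> coef_tuple d (mp x) \in irr_tuples d.
  have [_ m_mp irr_mp sz_mp] := mpP x => dx; rewrite inE; apply/irreducibleP.
  by rewrite coef_tupleK // sz_mp -dx degE.
rewrite (partition_big (fun x : finvect_type L => coef_tuple d (mp x))
           (mem (irr_tuples d))) /=; last by move=> x /eqP /mem_irr.
rewrite mulnC -sum_nat_const; apply: eq_bigr => t.
rewrite inE => /irreducibleP irr_t.
rewrite sum1_card -{1}[d : nat]/d.+1.-1 -(size_monic_of t).
rewrite -(card_roots_irredp (L := L)) ?size_monic_of ?dimL //.
apply: eq_card => x; rewrite !inE; have [mpE m_mp irr_mp sz_mp] := mpP x.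
have mpx : root (map_poly (in_alg L) (mp x)) x by rewrite mpE root_minPoly.
apply/idP/andP => [tx | [/eqP dx /eqP <-]]; last first.
  by rewrite coef_tupleK // sz_mp -dx degE.
have dx : deg x = d by apply/val_inj; rewrite /= degE (irredp_dim irr_t tx) size_monic_of.
split; first exact/eqP.
suff <- : monic_of t = mp x by rewrite monic_ofK.
have dvd_mp : mp x %| monic_of t := irredp_dvdp_root irr_mp mpx tx.
apply/eqP; rewrite eq_sym -eqp_monic ?monic_of_monic //.
by rewrite (apply_irredp irr_t) // sz_mp eqSS -lt0n adim_gt0.
Qed.

Lemma sum_divisors_irr_tuples n : (0 < n)%N ->
  (\sum_(d <- divisors n) d * #|irr_tuples d| = q ^ n)%N.
Proof.
move=> n0; rewrite -sum_irr_tuples // -(big_mkord (dvdn^~ n) (fun d => d * #|irr_tuples d|)%N).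
rewrite -[RHS]big_filter; apply: perm_big; apply: uniq_perm.
- exact: divisors_uniq.
- by rewrite filter_uniq ?iota_uniq.
move=> d; rewrite mem_filter mem_index_iota ltnS -dvdn_divisors //=.
by have [/(dvdn_leq n0)->|] := boolP (d %| n)%N.
Qed.

(** * Counting polynomials with a given factorization type *)

Definition fact_tuples lam :=
  [set t : (sumn lam).-tuple F | `[< has_fact_type lam (monic_of t) >]].

Lemma has_fact_type_size lam f : has_fact_type lam f ->
  f \is monic /\ size f = (sumn lam).+1.
Proof.
case=> s [_ ms _ -> <-]; elim: s ms => [|p s IHs] /=; first by rewrite big_nil monic1 size_poly1.
case/andP=> mp /IHs[mf szf]; rewrite big_cons; split; first by rewrite monicMl.
rewrite size_Mmonic ?monic_neq0 // szf addnS /= -addSn prednK //.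
by rewrite size_poly_gt0 monic_neq0.
Qed.

(** As [d] is not in [lam], the new factor differs in degree from those of [g], so the list of
    factors stays duplicate-free. *)
Lemma has_fact_type_cons d lam f : d \notin lam -> has_fact_type (d :: lam) f <->
  exists p g, [/\ p \is monic, irreducible_poly p, size p = d.+1,
    has_fact_type lam g & f = p * g].
Proof.
move=> dNlam; split=> [[[|p s] [//= /andP[_ us] /andP[mp ms] irr -> [<- lamE]]]|].
  have irr_p : irreducible_poly p by apply: irr; rewrite mem_head.
  exists p, (\prod_(p <- s) p); rewrite big_cons; split=> //.
    by rewrite prednK // size_poly_gt0 monic_neq0.
  by exists s; split=> // r rs; apply: irr; rewrite inE rs orbT.
case=> p [g [mp irr szp [s [us ms irr_s -> lamE]] ->]].
exists (p :: s); rewrite /= us mp ms big_cons szp lamE andbT; split=> //.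
  by apply: contra dNlam => ps; rewrite -lamE; apply/mapP; exists p; rewrite ?szp.
by move=> r; rewrite inE => /orP[/eqP->|/irr_s].
Qed.

Lemma irredp_dvdp_fact_type lam f p : irreducible_poly p -> p %| f ->
  has_fact_type lam f -> (size p).-1 \in lam.
Proof.
move=> irr pf [s [_ _ irr_s fE <-]]; rewrite {}fE in pf; elim: s irr_s pf => [|r s IHs] irr_s.
  by rewrite big_nil dvdp1 => /eqP sz1; move: irr.1; rewrite sz1.
have irr_r : irreducible_poly r by apply: irr_s; rewrite mem_head.
rewrite big_cons inE; have [p_r _ | pNr] := boolP (p %| r).
  have szp : size p != 1%N by rewrite neq_ltn irr orbT.
  by rewrite (eqp_size (apply_irredp irr_r szp p_r)) eqxx.
rewrite Gauss_dvdpr ?irreducible_poly_coprime // => /IHs-> //; first exact: orbT.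
by move=> t ts; apply: irr_s; rewrite inE ts orbT.
Qed.

(** Multiplication is injective on pairs: a second irreducible factor of degree [d] would divide the
    cofactor, whose irreducible factors have degrees in [lam]. *)
Lemma card_fact_tuples_cons d lam : d \notin lam ->
  #|fact_tuples (d :: lam)| = (#|irr_tuples d| * #|fact_tuples lam|)%N.
Proof.
move=> dNlam; pose mul (u : d.-tuple F * (sumn lam).-tuple F) :=
  coef_tuple (sumn (d :: lam)) (monic_of u.1 * monic_of u.2).
have mulE u : monic_of (mul u) = monic_of u.1 * monic_of u.2.
  rewrite coef_tupleK ?monicMl ?monic_of_monic //.
  by rewrite size_Mmonic ?monic_neq0 ?monic_of_monic // !size_monic_of addnS.
rewrite -cardsX -(card_in_imset (f := mul)); last first.
  move=> [t u] [t' u']; rewrite !inE /=.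
  case/andP=> /irreducibleP irr_t _ /andP[/irreducibleP irr_t' /asboolP hu'].
  move/(congr1 (@monic_of F _)); rewrite !mulE /= => tuE.
  have tE : t = t'.
    apply: (can_inj (@monic_ofK d)); apply/eqP; rewrite -eqp_monic ?monic_of_monic //.
    apply: (apply_irredp irr_t'); first by rewrite neq_ltn irr_t orbT.
    have : monic_of t %| monic_of t' * monic_of u' by rewrite -tuE dvdp_mulr.
    apply: contraLR => ttN; rewrite Gauss_dvdpr ?irreducible_poly_coprime //.
    apply/negP => tu; have := irredp_dvdp_fact_type irr_t tu hu'.
    by rewrite size_monic_of (negPf dNlam).
  move: tuE; rewrite tE => /(mulfI (monic_neq0 (monic_of_monic _))).
  by move/(can_inj (@monic_ofK _)) ->.
apply: eq_card => t; rewrite inE; apply/asboolP/imsetP => [|[[u v]]].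
  case/(has_fact_type_cons _ dNlam) => p [g [mp irr szp hg tE]].
  have [mg szg] := has_fact_type_size hg.
  exists (coef_tuple d p, coef_tuple (sumn lam) g); last first.
    by rewrite /mul /= !coef_tupleK // -tE monic_ofK.
  rewrite !inE /= !coef_tupleK //.
  by apply/andP; split; [exact/irreducibleP | exact/asboolP].
rewrite !inE /= => /andP[/irreducibleP irr_u /asboolP hv] ->.
apply/has_fact_type_cons => //; exists (monic_of u), (monic_of v).
by rewrite mulE size_monic_of monic_of_monic.
Qed.

Lemma prime_dvdn_fact_tuples (p : nat) lam : prime p -> uniq lam ->
  all (fun d => ~~ (p %| #|irr_tuples d|)%N) lam -> ~~ (p %| #|fact_tuples lam|)%N.
Proof.
move=> p_pr; elim: lam => [_ _ | d lam IHlam /= /andP[dNlam ulam] /andP[pd plam]].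
  suff -> : fact_tuples [::] = setT by rewrite cardsT card_tuple expn0 dvdn1 neq_ltn prime_gt1 ?orbT.
  apply/setP => t; rewrite !inE; apply/asboolP; exists [::]; split => //.
  (* The only tuple is the empty one, and it encodes 1, the empty product. *)
  rewrite big_nil -(@coef_tupleK 0 1) ?monic1 ?size_poly1 //; congr monic_of.
  exact: etrans (tuple0 t) (esym (tuple0 _)).
by rewrite card_fact_tuples_cons // Euclid_dvdM // negb_or pd IHlam.
Qed.

(** Turns the relation [is_disc] into the value of a function, along whose fibres [fact_tuples] can
    be partitioned. *)
Lemma count_discE lam (a : F) : count_disc (sumn lam) lam a
  = #|[set t in fact_tuples lam | hankel_disc (monic_of t) == a]|.
Proof.
apply: eq_card => t; rewrite !inE; apply/asboolP/andP => [[ht dt] | [/asboolP ht /eqP dt]].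
  split; first exact/asboolP.
  by move/(is_disc_hankel _ (monic_of_monic t)): dt => ->.
by split=> //; apply/(is_disc_hankel _ (monic_of_monic t)).
Qed.

(** By separability the discriminants are nonzero, so there are [q - 1] fibres, each as large as the
    one over 1. *)
Lemma dvdn_fact_tuples lam :
  (forall a b : F, a != 0 -> b != 0 ->
     count_disc (sumn lam) lam a = count_disc (sumn lam) lam b) ->
  (q.-1 %| #|fact_tuples lam|)%N.
Proof.
move=> hequi; apply/dvdnP; exists (count_disc (sumn lam) lam (1 : F)).
rewrite -sum1_card (partition_big (fun t => hankel_disc (monic_of t)) (predC1 0)) /=; last first.
  by move=> t; rewrite inE => /asboolP; apply/hankel_disc_fact_type/monic_of_monic.
transitivity (\sum_(a in predC1 (0%R : F)) count_disc (sumn lam) lam (1%R : F))%N; last first.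
  by rewrite sum_nat_const cardC1 mulnC.
apply: eq_bigr => a a0; rewrite (hequi 1 a) ?oner_neq0 // count_discE sum1_card.
by apply: eq_card => t; rewrite unfold_in !inE.
Qed.

End FiniteField.

(** * Binary digits and the choice of the partition *)

Lemma exists_binary n : exists s, uniq s /\ sumn (map (expn 2) s) = n.
Proof.
have [k] := ubnP n; elim: k n => // k IHk [|n] lt_nk; first by exists [::].
have [|s [us sE]] := IHk n.+1./2.
  by rewrite -ltnS (leq_trans _ lt_nk) // ltnS; lia.
(* The parity gives the digit of weight 1; the exponents found for the half are shifted by one. *)
exists (nseq (odd n.+1) 0 ++ map S s)%N; split.
  rewrite cat_uniq map_inj_uniq ?us //; last exact: succn_inj.
  case: (odd _) => //=; rewrite andbT; apply/hasPn => x /mapP[y _ ->] //.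
rewrite map_cat sumn_cat -map_comp.
have -> : sumn (map (expn 2 \o S) s) = (2 * sumn (map (expn 2) s))%N.
  by elim: s {us sE} => //= x s ->; rewrite mulnDr expnS.
rewrite sE mul2n -[RHS]odd_double_half; congr (_ + _)%N.
by case: (odd _).
Qed.

Theorem theorem5p3 (F : finFieldType) (q k m : nat)
  (hF : #|F| = q) (hq : q = (2 ^ k)%N) (hsq : squarefree_nat q.-1)
  (hm : (2 <= m)%N)
  (hequi : forall lam : seq nat, is_partition m lam ->
     forall a b : F, a != 0 -> b != 0 -> count_disc m lam a = count_disc m lam b) :
  gcdn q.-1 (m * m.-1) = 1%N.
Proof.
have q_gt1 : (1 < q)%N by rewrite -hF finNzRing_gt1.
have q1_gt0 : (0 < q.-1)%N by rewrite -subn1 subn_gt0.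
apply/eqP; apply: contraT => ncop.
set g := gcdn _ _ in ncop.
have [p p_pr p_g] : exists2 p, prime p & (p %| g)%N.
  by exists (pdiv g); rewrite ?pdiv_dvd // pdiv_prime // ltn_neqAle eq_sym ncop gcdn_gt0 q1_gt0.
have /andP[pq1 pm] : (p %| q.-1)%N && (p %| m * m.-1)%N by rewrite -dvdn_gcd.
(* [q > 1] forces [k > 0], so [q - 1] is odd. *)
have p_odd : odd p.
  apply: dvdn_odd pq1 _; case: k hq q_gt1 => [->//|k ->].
  by rewrite -subn1 oddB ?expn_gt0 // oddX.
have p2Nq1 : ~~ (p * p %| q.-1)%N by apply: hsq; exact: prime_gt1.
have [M [r [r1 mE]]] : exists M r, (r <= 1)%N /\ m = (p * M + r)%N.
  move: pm; rewrite Euclid_dvdM // => /orP[] /dvdnP[M ME].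
    by exists M, 0%N; rewrite addn0 mulnC.
  by exists M, 1%N; rewrite addn1 mulnC -ME prednK // ltnW.
have [s [us sE]] := exists_binary M.
pose parts := (map (fun b => p * 2 ^ b) s ++ nseq r 1)%N.
pose lam := sort geq parts.
have lamP : perm_eq lam parts by rewrite perm_sort.
have sum_lam : sumn lam = m.
  rewrite (perm_sumn lamP) sumn_cat sumn_nseq mul1n mE; congr (_ + _)%N.
  by rewrite -sE; elim: (s) => [|b s' /= ->]; rewrite ?muln0 //= mulnDr.
have ulam : uniq lam.
  rewrite (perm_uniq lamP) cat_uniq map_inj_uniq ?us /=; last first.
    move=> a b /eqP; rewrite eqn_pmul2l ?prime_gt0 // eqn_exp2l // => /eqP //.
  case: r r1 {mE parts lam lamP sum_lam} => [|[|//]] //= _.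
  (* The extra part 1 is not a multiple of [p]. *)
  rewrite orbF andbT; apply/mapP => -[b _] /esym/eqP.
  by rewrite muln_eq1 => /andP[/eqP p1 _]; rewrite p1 in p_pr.
have part_lam : is_partition m lam.
  rewrite /is_partition sum_lam eqxx andbT sort_sorted => [|a b]; last exact: leq_total.
  rewrite /= (perm_all _ lamP) all_cat all_nseq orbT andbT.
  by apply/allP => _ /mapP[b _ ->]; rewrite muln_gt0 prime_gt0 // expn_gt0.
have p_lam : (p %| #|fact_tuples F lam|)%N.
  apply: dvdn_trans pq1 _; rewrite -hF; apply: dvdn_fact_tuples => a b a0 b0.
  by rewrite sum_lam; exact: hequi.
apply: contraLR p_lam => _; apply: prime_dvdn_fact_tuples => //.
rewrite (perm_all _ lamP) all_cat all_nseq; apply/andP; split.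
  apply/allP => _ /mapP[b _ ->].
  apply: (prime_dvdn_N p_pr p_odd (ltnW q_gt1) pq1 (N := fun d => #|irr_tuples F d|)) => //.
  by move=> n n0; rewrite -hF; apply: sum_divisors_irr_tuples.
(* A part 1 contributes the factor [q = (q - 1) + 1], which is prime to [p]. *)
apply/orP; right; have := sum_divisors_irr_tuples F (ltn0Sn 0).
rewrite big_seq1 mul1n expn1 hF => ->.
rewrite -(prednK (ltnW q_gt1)) -addn1 dvdn_addr // dvdn1.
by rewrite neq_ltn prime_gt1 // orbT.
Qed.
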